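(* For $n\ge 3$ let $P$ be the probability measure on the alternating group $A_n$ that assigns mass $\frac{1}{2n-3}$ to each of the identity, the $3$-cycles $(i,n-1,n)$ and the $3$-cycles $(i,n,n-1)$, $1\le i\le n-2$, and mass $0$ to all other elements. Let $U_{A_n}$ be the uniform distribution on $A_n$. Then: (1) There is $c_0<0$ such that for every real $c\le c_0$ there is a sequence $\delta_n\to0$ such that, for all sufficiently large $n$ and $k=\lfloor (n-\frac32)(\log n+c)\rfloor$, $$\|P^{*k}-U_{A_n}\|_{\mathrm{TV}}\ \ge\ 1-\frac{6}{1+e^{-c}(1+\delta_n)}.$$ (2) For every $\epsilon\in(0,1)$, with $k_n=\lfloor(1-\epsilon)(n-\frac32)\log n\rfloor$, one has $\lim_{n\to\infty}\|P^{*k_n}-U_{A_n}\|_{\mathrm{TV}}=1$.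
   Context: For probability measures $p,q$ on a finite group $G$, the convolution is $(p*q)(x)=\sum_{y\in G}p(xy^{-1})q(y)$, and $p^{*k}$ is the $k$-fold convolution of $p$ with itself. The total variation distance is $\|\mu-\nu\|_{\mathrm{TV}}=\sup_{A\subset\Omega}|\mu(A)-\nu(A)|$. $\log$ is the natural logarithm and $\lfloor x\rfloor$ is the floor of $x$. The measure $P$ depends on $n$, although this is suppressed in the notation. *)

(* Defs.v *)
From HB Require Import structures.
From mathcomp Require Import all_boot all_order all_algebra all_fingroup all_solvable.
From mathcomp Require Import all_classical all_reals all_analysis.

Set Implicit Arguments.
Unset Strict Implicit.
Unset Printing Implicit Defensive.

Import Order.TTheory GRing.Theory Num.Theory.
Import numFieldNormedType.Exports.

Local Open Scope classical_set_scope.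
Local Open Scope ring_scope.

(* Probability measures on a finite type are represented by their mass
   functions. *)

Definition conv (R : realType) (gT : finGroupType) (p q : gT -> R) : gT -> R :=
  fun x => \sum_(y : gT) p (x * y^-1)%g * q y.

(* The empty convolution is the point mass at the identity. *)
Definition convn (R : realType) (gT : finGroupType) (p : gT -> R) (k : nat) :
    gT -> R :=
  iter k (conv p) (fun x => (x == 1%g)%:R).

Definition uniform_mass (R : realType) (T : finType) : T -> R :=
  fun=> #|T|%:R^-1.
Arguments uniform_mass R T : clear implicits.

Definition tv_dist (R : realType) (T : finType) (mu nu : T -> R) : R :=
  sup [set `|\sum_(x in A) mu x - \sum_(x in A) nu x| | A in [set: {set T}]].

(* The alternating group as a group type in its own right. *)
Definition altT (n : nat) : finGroupType := [subg 'Alt_('I_n)].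

(* The cycle i -> j -> k -> i, for distinct i, j, k: products of permutations
   are composed from left to right. *)
Definition cycle3 (T : finType) (i j k : T) : {perm T} :=
  (tperm i j * tperm i k)%g.

Lemma cycle3E (T : finType) (i j k : T) : uniq [:: i; j; k] ->
  [/\ cycle3 i j k i = j, cycle3 i j k j = k, cycle3 i j k k = i &
      forall l, l \notin [:: i; j; k] -> cycle3 i j k l = l].
Proof.
rewrite /= !inE negb_or andbT => /andP[/andP[ij ik] jk].
split=> [|||l]; last rewrite !inE !negb_or => /and3P[li lj lk].
all: rewrite /cycle3 permM.
- by rewrite tpermL tpermD // eq_sym.
- by rewrite tpermR tpermL.
- by rewrite (tpermD ik jk) tpermR.
- by rewrite !tpermD // eq_sym.
Qed.

(* The points 1, ..., n are the ordinals 0, ..., n - 1, so that a and b below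
   are the points n - 1 and n. *)
Definition shuffle_support (n : nat) (s : {perm 'I_n}) : bool :=
  (s == 1%g) ||
  [exists i : 'I_n, exists a : 'I_n, exists b : 'I_n,
    [&& (i < n - 2)%N, a == (n - 2)%N :> nat, b == (n - 1)%N :> nat &
        (s == cycle3 i a b) || (s == cycle3 i b a)]].

(* The values for n < 3 are junk; for n >= 3 the support has exactly 2n - 3
   elements, all of them even. *)
Definition shuffle_mass (R : realType) (n : nat) : altT n -> R :=
  fun x => if shuffle_support (sgval x) then (2 * n%:R - 3)^-1 else 0.
Arguments shuffle_mass R n : clear implicits.

(* Main.v *)
(* A product of k steps fixes every point i <= n - 2 that no step has moved. Each
such point is moved by a step with probability 1 / (n - 3/2), so by coupon
collecting the number of unmoved points has mean
m = (n - 2) (1 - 1 / (n - 3/2))^k, and its variance is at most m because the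
events are pairwise negatively correlated. A uniform even permutation has one
fixed point on average. The event of having at least m / 3 fixed points among
the first n - 2 therefore separates the two laws by at least 1 - (21/4) / m.
For k = floor((n - 3/2)(log n + c)) one has m -> e^(-c), and
(21/4) / m <= 6 / (1 + m) as soon as m >= 7. The second claim follows from the
same limit, as m decreases with k and c is arbitrary. *)
Require Import Defs.
From HB Require Import structures.
From mathcomp Require Import all_boot all_order all_algebra all_fingroup all_solvable.
From mathcomp Require Import all_classical all_reals all_analysis.
From mathcomp Require Import ring lra zify.
Import Order.TTheory GRing.Theory Num.Theory.
Import numFieldNormedType.Exports.
Local Open Scope classical_set_scope.
Local Open Scope ring_scope.

Set Implicit Arguments.
Unset Strict Implicit.
Unset Printing Implicit Defensive.

(** * Expectations over words of independent steps *)

(** The expectation of [f] over words of [k] independent letters of law [p]. Keeping the whole word,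
    and not only its product, makes it possible to ask which points no letter has moved. *)
Fixpoint word_mean (R : realType) (gT : finGroupType) (p : gT -> R) (k : nat)
    (f : seq gT -> R) : R :=
  if k is k'.+1 then \sum_s p s * word_mean p k' (fun l => f (s :: l))
  else f [::].

Section WordMean.
Context (R : realType) (gT : finGroupType) (p : gT -> R).
Implicit Types (f g : seq gT -> R) (k : nat).

Lemma eq_word_mean k f g : f =1 g -> word_mean p k f = word_mean p k g.
Proof.
elim: k f g => [|k IH] f g fg /=; first exact: fg.
by apply: eq_bigr => s _; congr (_ * _); apply: IH => l; exact: fg.
Qed.

Lemma word_meanD k f g :
  word_mean p k (fun l => f l + g l) = word_mean p k f + word_mean p k g.
Proof.
elim: k f g => [|k IH] f g //=; rewrite -big_split /=.
by apply: eq_bigr => s _; rewrite IH mulrDr.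
Qed.

Lemma word_meanZ k c f :
  word_mean p k (fun l => c * f l) = c * word_mean p k f.
Proof.
elim: k f => [|k IH] f //=; rewrite big_distrr /=.
by apply: eq_bigr => s _; rewrite IH mulrCA.
Qed.

Lemma word_mean_sum (I : finType) (P : pred I) k (F : I -> seq gT -> R) :
  word_mean p k (fun l => \sum_(i | P i) F i l) =
  \sum_(i | P i) word_mean p k (F i).
Proof.
elim: k F => [|k IH] F //=; rewrite exchange_big /=.
by apply: eq_bigr => s _; rewrite IH big_distrr.
Qed.

(** The weight of a word is a product over its letters, and so is the indicator; hence the sum
    factorises. *)
Lemma word_mean_all k (h : pred gT) :
  word_mean p k (fun l => (all h l)%:R) = (\sum_s p s * (h s)%:R) ^+ k.
Proof.
elim: k => [|k IH] //=; rewrite exprS big_distrl /=.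
apply: eq_bigr => s _; rewrite -mulrA; congr (_ * _).
by rewrite -IH -word_meanZ; apply: eq_word_mean => l; rewrite -natrM mulnb.
Qed.

Lemma le_word_mean k f g : (forall s, 0 <= p s) -> (forall l, f l <= g l) ->
  word_mean p k f <= word_mean p k g.
Proof.
move=> p0; elim: k f g => [|k IH] f g fg /=; first exact: fg.
by apply: ler_sum => s _; apply: ler_wpM2l => //; apply: IH => l; exact: fg.
Qed.

Lemma word_mean_cst k c : \sum_s p s = 1 -> word_mean p k (fun=> c) = c.
Proof.
move=> p1; elim: k => [|k IH] //=.
by under eq_bigr do rewrite IH; rewrite -big_distrl /= p1 mul1r.
Qed.

(** The product of a random word has law [convn p k]: [convn] puts each new factor on the left, as
    consing a letter does. *)
Lemma sum_convn k (g : gT -> R) :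
  \sum_x convn p k x * g x = word_mean p k (fun l => g (\prod_(s <- l) s)%g).
Proof.
elim: k g => [|k IH] g /=.
  rewrite big_nil (bigD1 1%g) //= eqxx mul1r big1 ?addr0 // => x /negbTE->.
  by rewrite mul0r.
rewrite /conv; under eq_bigr do rewrite big_distrl /=.
rewrite exchange_big /=.
(* The substitution x = s y turns [p (x * y^-1)] into [p s]. *)
transitivity (\sum_y \sum_s p s * convn p k y * g (s * y)%g).
  apply: eq_bigr => y _; rewrite (reindex_inj (mulIg y)) /=.
  by apply: eq_bigr => s _; rewrite mulgK.
rewrite exchange_big /=; apply: eq_bigr => s _.
under eq_word_mean do rewrite big_cons.
rewrite -(IH (fun y => g (s * y)%g)) big_distrr.
by apply: eq_bigr => y _; rewrite -mulrA.
Qed.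

End WordMean.

(** * Bounds on the total variation distance *)

Section TotalVariation.
Context (R : realType) (T : finType) (mu nu : T -> R).
Hypotheses (mu0 : forall x, 0 <= mu x) (nu0 : forall x, 0 <= nu x).
Hypotheses (mu1 : \sum_x mu x = 1) (nu1 : \sum_x nu x = 1).

(** This bounds the set whose [sup] is [tv_dist], so that each of its members lies below the
    [sup]. *)
Lemma tv_dist_ubound (A : {set T}) :
  `|\sum_(x in A) mu x - \sum_(x in A) nu x| <= 1.
Proof.
have H (f : T -> R) : (forall x, 0 <= f x) -> \sum_x f x = 1 ->
    0 <= \sum_(x in A) f x <= 1.
  move=> f0 f1; rewrite sumr_ge0 //= -f1 [leRHS](bigID (mem A)) /=.
  by rewrite lerDl sumr_ge0.
have /andP[? ?] := H _ mu0 mu1; have /andP[? ?] := H _ nu0 nu1.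
rewrite ler_norml; lra.
Qed.

Lemma tv_dist_le1 : tv_dist mu nu <= 1.
Proof.
apply: ge_sup; last by move=> _ [A _ <-]; exact: tv_dist_ubound.
by eexists; exists finset.set0.
Qed.

Lemma le_tv_dist (A : {set T}) :
  \sum_(x in A) mu x - \sum_(x in A) nu x <= tv_dist mu nu.
Proof.
apply: le_trans (ler_norm _) _; apply: ub_le_sup; last by exists A.
by exists 1 => _ [B _ <-]; exact: tv_dist_ubound.
Qed.

End TotalVariation.

(** * The second-moment lower bound on a finite group *)

Section SecondMoment.
Context (R : realType) (gT : finGroupType) (p : gT -> R).
Hypotheses (p0 : forall s, 0 <= p s) (p1 : \sum_s p s = 1).

Lemma convn_ge0 k x : 0 <= convn p k x.
Proof.
elim: k x => [|k IH] x /=; first exact: ler0n.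
by apply: sumr_ge0 => y _; exact: mulr_ge0.
Qed.

Lemma sum_convn1 k : \sum_x convn p k x = 1.
Proof.
transitivity (\sum_x convn p k x * 1).
  by apply: eq_bigr => x; rewrite mulr1.
by rewrite (sum_convn p k (fun=> 1)) word_mean_cst.
Qed.

Lemma uniform_ge0 x : 0 <= uniform_mass R gT x.
Proof. by rewrite invr_ge0. Qed.

Lemma sum_uniform : \sum_x uniform_mass R gT x = 1.
Proof.
rewrite sumr_const -[LHS]mulr_natr mulVf // pnatr_eq0 -lt0n.
by apply/card_gt0P; exists 1%g.
Qed.

(** In the application [h i s] says that [s] fixes the point [i], and [J] is the set of the first n
    - 2 points. Then [a] and [b] are the probabilities that a step fixes one and two given points of
    [J], [le_b] is negative correlation, and [unif_h] says that a uniform element fixes at most one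
    point of [J] on average. *)
Context (I : finType) (J : {set I}) (h : I -> pred gT) (a b : R).
Hypothesis h1 : forall i, h i 1%g.
Hypothesis hM : forall i s t, h i s -> h i t -> h i (s * t)%g.
Hypothesis mean_h : forall i, i \in J -> \sum_s p s * (h i s)%:R = a.
Hypothesis mean_hh : forall i j, i \in J -> j \in J -> i != j ->
  \sum_s p s * (h i s && h j s)%:R = b.
Hypothesis le_b : b <= a ^+ 2.
Hypothesis unif_h : \sum_s #|[set i in J | h i s]|%:R <= #|gT|%:R :> R.

(** The number of points of [J] moved by no letter of the word; its mean is [m k]. *)
Let N (l : seq gT) : R := \sum_(i in J) (all (h i) l)%:R.
Let m k : R := #|J|%:R * a ^+ k.

Let mean_N k : word_mean p k N = m k.
Proof.
rewrite word_mean_sum /m mulr_natl -sumr_const.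
by apply: eq_bigr => i iJ; rewrite word_mean_all mean_h.
Qed.

(** In the double sum over pairs the diagonal gives [m k]. Each off-diagonal term is b^k <= a^(2k),
    and completing these with the missing diagonal gives [m k ^+ 2]. *)
Let mean_N2 k : word_mean p k (fun l => N l ^+ 2) <= m k + m k ^+ 2.
Proof.
have -> : word_mean p k (fun l => N l ^+ 2) =
    \sum_(i in J) \sum_(j in J) (\sum_s p s * (h i s && h j s)%:R) ^+ k.
  under eq_word_mean.
    move=> l; rewrite expr2 /N big_distrl /=.
    under eq_bigr do rewrite big_distrr /=.
    over.
  rewrite word_mean_sum; apply: eq_bigr => i _.
  rewrite word_mean_sum; apply: eq_bigr => j _.
  rewrite -word_mean_all; apply: eq_word_mean => l.
  by rewrite -natrM mulnb -all_predI.
have -> : m k + m k ^+ 2 =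
    \sum_(i in J) (a ^+ k + \sum_(j in J) (a ^+ 2) ^+ k).
  rewrite big_split /= !sumr_const /m !mulr_natl exprMn_n -!mulrnA -mulnn.
  by rewrite -exprM mulnC exprM.
apply: ler_sum => i iJ; rewrite (bigD1 i) //= [in leRHS](bigD1 i) //=.
rewrite lerD //.
  by under eq_bigr do rewrite andbb; rewrite mean_h.
rewrite addrC; apply: ler_wpDr.
  by rewrite exprn_ge0 // sqr_ge0.
apply: ler_sum => j /andP[jJ ji]; rewrite mean_hh 1?eq_sym //.
apply: lerXn2r => //; rewrite ?nnegrE ?sqr_ge0 //.
(* Raising [b <= a ^+ 2] to the power [k] needs b >= 0, which holds because [b] is a sum of
   nonnegative terms. *)
rewrite -(mean_hh iJ jJ) 1?eq_sym // sumr_ge0 // => s _.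
by rewrite mulr_ge0.
Qed.

(* Chebyshev for the words and Markov for the uniform measure at the threshold
   [m / 3]; the costs are [9/4 / m] and [3 / m]. *)
Lemma second_moment_tv_dist k : 0 < #|J|%:R * a ^+ k ->
  1 - 21 / 4 / (#|J|%:R * a ^+ k) <=
  tv_dist (convn p k) (uniform_mass R gT).
Proof.
rewrite -/(m k) => m_gt0; set M := m k in m_gt0 *.
pose F s : R := #|[set i in J | h i s]|%:R.
pose A := [set s | M / 3 <= F s]%SET.
have muA : 1 - 9 / 4 / M <= \sum_(x in A) convn p k x.
  have -> : \sum_(x in A) convn p k x =
      word_mean p k (fun l => ((\prod_(s <- l) s)%g \in A)%:R).
    rewrite -(sum_convn p k (fun x => (x \in A)%:R)) big_mkcond /=.
    by apply: eq_bigr => x _; case: (x \in A); rewrite (mulr1, mulr0).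
  (* Chebyshev in pointwise form: the indicator of [A] is at least 1 - (3/2 (1 - N/M))^2, since
     outside [A] one has N/M <= 1/3 and the square is at least 1. [B] is the coefficient of N^2 in
     that square. *)
  pose B := (9 / 4 / M ^+ 2) : R.
  (* A point that no letter moves is fixed by the product. *)
  have NF l : N l <= F (\prod_(s <- l) s)%g.
    rewrite /N -natr_sum /F ler_nat -sum1_card big_mkcond [leqRHS]big_mkcond /=.
    apply: leq_sum => i _; rewrite inE; case: (i \in J) => //=.
    case: (boolP (all _ _)) => // hl; suff -> : h i (\prod_(s <- l) s)%g by [].
    elim: l hl => [|s l IH]; first by rewrite big_nil.
    by rewrite big_cons => /andP[? /IH]; exact: hM.
  apply: (@le_trans _ _ (word_mean p k
      (fun l => (1 - B * M ^+ 2) + (2 * B * M * N l + (- B) * N l ^+ 2)))).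
    rewrite !word_meanD !word_meanZ !word_mean_cst // mean_N.
    have B0 : 0 <= B by rewrite /B divr_ge0 ?sqr_ge0.
    have := ler_wpM2l B0 (mean_N2 k).
    rewrite -/M; have -> : B * (M + M ^+ 2) = 9 / 4 / M + B * M ^+ 2.
      by rewrite /B; field; rewrite gt_eqF.
    lra.
  apply: le_word_mean => // l; rewrite inE.
  have -> : (1 - B * M ^+ 2) + (2 * B * M * N l + (- B) * N l ^+ 2) =
    1 - (3 / 2 * (1 - N l / M)) ^+ 2 by rewrite /B; field; rewrite gt_eqF.
  have [_|lt] := leP (M / 3); first by rewrite lerBlDr lerDl sqr_ge0.
  have : N l / M <= 1 / 3 by rewrite ler_pdivrMr //; have := NF l; lra.
  move=> NM; rewrite subr_le0 -[leLHS](expr1n R 2) lerXn2r ?nnegrE //; lra.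
have nuA : \sum_(x in A) uniform_mass R gT x <= 3 / M.
  have C0 : 0 < #|gT|%:R :> R.
    by rewrite ltr0n; apply/card_gt0P; exists 1%g.
  rewrite sumr_const /uniform_mass -[leLHS]mulr_natl ler_pdivrMr //.
  rewrite mulrAC ler_pdivlMr // mulrC.
  (* Markov: every element of [A] contributes at least M / 3 to the sum in [unif_h]. *)
  have : M / 3 * #|A|%:R <= #|gT|%:R; last by lra.
  apply: le_trans unif_h; rewrite mulr_natr -sumr_const big_mkcond /=.
  by apply: ler_sum => s _; rewrite inE; case: ifP => // _; exact: ler0n.
have := le_tv_dist (convn_ge0 k) uniform_ge0 (sum_convn1 k) sum_uniform A.
have -> : 21 / 4 / M = 9 / 4 / M + 3 / M by field; rewrite gt_eqF.
lra.
Qed.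

End SecondMoment.

(** * Sums over the alternating group and over the support of the shuffle *)

Lemma sum_alt (R : realType) n (f : {perm 'I_n} -> R) :
  \sum_(x : altT n) f (sgval x) = \sum_(s in ('Alt_('I_n))%g) f s.
Proof.
rewrite [RHS](reindex_onto (@sgval _ _) (subg ('Alt_('I_n))%G)) /=.
  by apply: eq_bigl => x; rewrite subgP sgvalK eqxx.
by move=> s sA; rewrite subgK.
Qed.

Lemma cycle3_even (T : finType) (i j k : T) : uniq [:: i; j; k] ->
  cycle3 i j k \in ('Alt_T)%g.
Proof.
rewrite Alt_even /= !inE negb_or => /andP[/andP[ij ik] _].
by rewrite odd_permM !odd_tperm ij ik.
Qed.

(** By orbit counting: the alternating group is transitive for n > 2, so its elements have one fixed
    point on average; restricting to [J] can only lower the count. *)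
Lemma sum_fixed_points (R : realType) n (J : {set 'I_n}) : (2 < n)%N ->
  \sum_(x : altT n) #|[set i in J | sgval x i == i]|%:R <= #|altT n|%:R :> R.
Proof.
move=> n2; have n0 : (0 < n)%N by apply: leq_trans n2.
rewrite (sum_alt (fun s => #|[set i in J | s i == i]|%:R)) -natr_sum ler_nat.
have -> : #|altT n| = #|('Alt_('I_n))%g| by rewrite card_sub.
have tr : [transitive ('Alt_('I_n))%g, on [set: 'I_n]%SET | 'P].
  apply: (@ntransitive1 _ _ _ _ _ n.-2); first by rewrite -subn2 subn_gt0.
  by have := Alt_trans 'I_n; rewrite card_ord.
have := Frobenius_Cauchy (atrans_acts tr).
rewrite (_ : orbit _ _ @: _ = [set [set: 'I_n]]%SET); last first.
  apply/setP => S; rewrite inE; apply/imsetP/eqP => [[x _ ->]|->].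
    by rewrite (atransP tr).
  by exists (Ordinal n0); rewrite ?inE // (atransP tr) ?inE.
rewrite cards1 mul1n => <-; apply: leq_sum => s _; apply: subset_leq_card.
apply/fintype.subsetP => i; rewrite inE => /andP[_ /eqP si].
by apply/setIP; split; [rewrite inE|apply/afix1P].
Qed.

Lemma card_low n : #|[set i : 'I_n | (i < n - 2)%N]%SET| = (n - 2)%N.
Proof.
have le : (n - 2 <= n)%N by lia.
have inj : injective (widen_ord le).
  by move=> i j /(congr1 val) /= ij; apply: val_inj.
rewrite -[RHS]card_ord -(card_imset _ inj).
apply: eq_card => i; rewrite inE; apply/idP/imsetP => [lt|[j _ ->]] //=.
by exists (Ordinal lt) => //; apply: val_inj.
Qed.

(** The identity and the two families of 3-cycles are even, pairwise disjoint and injectively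
    indexed by [i], so no term of the sum is counted twice. *)
Lemma sum_shuffle_mass (R : realType) n (g : {perm 'I_n} -> R) (a b : 'I_n) :
    (2 < n)%N -> a = (n - 2)%N :> nat -> b = (n - 1)%N :> nat ->
  \sum_x shuffle_mass R n x * g (sgval x) =
  (2 * n%:R - 3)^-1 * (g 1%g +
    \sum_(i : 'I_n | (i < n - 2)%N) (g (cycle3 i a b) + g (cycle3 i b a))).
Proof.
move=> n2 aE bE; have ab : a != b by rewrite -val_eqE /= aE bE; lia.
pose L := [set i : 'I_n | (i < n - 2)%N]%SET.
have La i : i \in L -> i != a.
  by rewrite inE -val_eqE /= aE; lia.
have Lb i : i \in L -> i != b.
  by rewrite inE -val_eqE /= bE; lia.
have u1 i : i \in L -> uniq [:: i; a; b].
  by move=> iL; rewrite /= !inE negb_or La // Lb // ab.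
have u2 i : i \in L -> uniq [:: i; b; a].
  by move=> iL; rewrite /= !inE negb_or La // Lb // eq_sym ab.
pose C1 := [set cycle3 i a b | i in L]%SET.
pose C2 := [set cycle3 i b a | i in L]%SET.
have suppE s : shuffle_support s = (s \in 1%g |: (C1 :|: C2)).
  rewrite /shuffle_support !inE; congr (_ || _).
  apply/existsP/orP => [[i /existsP[a' /existsP[b']]]|].
    move=> /and4P[iL /eqP a'E /eqP b'E].
    have -> : a' = a by apply: val_inj; rewrite /= a'E.
    have -> : b' = b by apply: val_inj; rewrite /= b'E.
    by case/orP => /eqP->; [left|right]; apply/imsetP; exists i; rewrite ?inE.
  case=> /imsetP[i iL ->]; exists i; apply/existsP; exists a; apply/existsP;
    exists b; rewrite inE in iL; rewrite iL aE bE !eqxx ?orbT //.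
rewrite (eq_bigr (fun x : altT n => (if shuffle_support (sgval x)
  then (2 * n%:R - 3)^-1 else 0) * g (sgval x))) //.
rewrite (sum_alt (fun s => (if shuffle_support s
  then (2 * n%:R - 3)^-1 else 0) * g s)).
transitivity (\sum_(s in 1%g |: (C1 :|: C2)) (2 * n%:R - 3)^-1 * g s).
  rewrite big_mkcond [RHS]big_mkcond; apply: eq_bigr => s _ /=.
  rewrite suppE; have [sS|_] := boolP (s \in 1%g |: (C1 :|: C2));
    last by rewrite /= mul0r if_same.
  suff -> : s \in ('Alt_('I_n))%g by [].
  move: sS; rewrite finset.in_setU1 => /predU1P[->|]; first exact: group1.
  by rewrite finset.in_setU => /orP[] /imsetP[i iL ->]; apply: cycle3_even;
    [exact: u1|exact: u2].
rewrite -big_distrr /=; congr (_ * _).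
(* The identity is not among the cycles, since each of these sends its [i] to [a] or [b]. *)
rewrite big_setU1 /=; last first.
  rewrite finset.in_setU; apply/negP => /orP[] /imsetP[i iL];
    move=> /(congr1 (fun s : {perm _} => s i)).
    have [-> _ _ _] := cycle3E (u1 i iL).
    by rewrite perm1; exact/eqP/La.
  have [-> _ _ _] := cycle3E (u2 i iL).
  by rewrite perm1; exact/eqP/Lb.
(* The index is recovered as the image of [b], and in the other family as the image of [a]. *)
have inj1 : {in L &, injective (fun i => cycle3 i a b)}.
  move=> i j iL jL /(congr1 (fun s : {perm _} => s b)).
  have [_ _ -> _] := cycle3E (u1 i iL).
  by have [_ _ -> _] := cycle3E (u1 j jL).
have inj2 : {in L &, injective (fun i => cycle3 i b a)}.
  move=> i j iL jL /(congr1 (fun s : {perm _} => s a)).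
  have [_ _ -> _] := cycle3E (u2 i iL).
  by have [_ _ -> _] := cycle3E (u2 j jL).
congr (_ + _); rewrite big_split /=.
rewrite (eq_bigl [predU C1 & C2]) => [|s]; last by rewrite !inE.
rewrite bigU /=; last first.
  (* The first family sends [a] to [b], the second sends it to a point of [L]. *)
  apply/fintype.pred0P => s; apply/negbTE/negP => /andP[/=].
  move=> /imsetP[i iL ->] /imsetP[j jL].
  move=> /(congr1 (fun s : {perm _} => s a)).
  have [_ -> _ _] := cycle3E (u1 i iL).
  have [_ _ -> _] := cycle3E (u2 j jL).
  by move=> /esym; exact/eqP/Lb.
rewrite !big_imset //=.
by congr (_ + _); apply: eq_bigl => i; rewrite inE.
Qed.

(** * One shuffle step, and the bound after [k] steps *)

Section ShuffleMass.
Context (R : realType) (n : nat).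
Hypothesis n2 : (2 < n)%N.

Let dpos : 0 < 2 * n%:R - 3 :> R.
Proof. by have : 3 <= n%:R :> R by [rewrite ler_nat]; lra. Qed.

Lemma shuffle_mass_ge0 x : 0 <= shuffle_mass R n x.
Proof. by rewrite /shuffle_mass; case: ifP => // _; rewrite invr_ge0 ltW. Qed.

Let sum_low1 : \sum_(i < n | (i < n - 2)%N) 1 = n%:R - 2 :> R.
Proof.
rewrite (eq_bigr (fun=> 1%:R)) // -natr_sum sum1_card -natrB; last exact: ltnW.
by congr _%:R; rewrite -[RHS]card_low; apply: eq_card => i; rewrite !inE.
Qed.

Let sum_low_eq (i : 'I_n) : (i < n - 2)%N ->
  \sum_(j < n | (j < n - 2)%N) (j == i)%:R = 1 :> R.
Proof.
move=> ilt; rewrite (bigD1 i) //= eqxx big1 ?addr0 // => j /andP[_ /negbTE->].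
by [].
Qed.

Let cycle3_low (i j c d : 'I_n) : (i < n - 2)%N -> (j < n - 2)%N ->
  (n - 2 <= c)%N -> (n - 2 <= d)%N -> c != d ->
  (cycle3 j c d i == i) = (j != i).
Proof.
move=> ilt jlt cge dge cd.
have ne (k e : 'I_n) : (k < n - 2)%N -> (n - 2 <= e)%N -> k != e.
  by move=> klt ege; apply: contraTneq klt => ->; rewrite -leqNgt.
have u : uniq [:: j; c; d].
  by rewrite /= !inE negb_or (ne j c) // (ne j d) // cd.
have [Ej _ _ El] := cycle3E u.
have [<-|ji] := eqVneq j i.
  by rewrite Ej eq_sym (negbTE (ne _ _ jlt cge)).
by rewrite El ?eqxx // !inE !negb_or (ne i c) // (ne i d) // eq_sym ji.
Qed.

(** For statistics that depend on a 3-cycle only through its low point, the two orientations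
    contribute equally; hence the factor 2. *)
Let sum_fix (g : {perm 'I_n} -> R) (f : 'I_n -> R) :
  g 1%g = 1 ->
  (forall j c d : 'I_n, (j < n - 2)%N -> (n - 2 <= c)%N -> (n - 2 <= d)%N ->
    c != d -> g (cycle3 j c d) = f j) ->
  \sum_x shuffle_mass R n x * g (sgval x) =
  (1 + 2 * \sum_(j < n | (j < n - 2)%N) f j) / (2 * n%:R - 3).
Proof.
move=> g1 gf.
have an : (n - 2 < n)%N by lia.
have bn : (n - 1 < n)%N by lia.
rewrite (@sum_shuffle_mass R n g (Ordinal an) (Ordinal bn)) // mulrC g1.
congr ((_ + _) / _); rewrite big_distrr /=; apply: eq_bigr => j jlt.
rewrite !gf //=; [by ring | lia | rewrite -val_eqE /=; lia | lia | ].
rewrite -val_eqE /=; lia.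
Qed.

Lemma sum_shuffle_mass1 : \sum_x shuffle_mass R n x = 1.
Proof.
transitivity (\sum_x shuffle_mass R n x * 1).
  by apply: eq_bigr => x; rewrite mulr1.
rewrite (sum_fix (g := fun=> 1) (f := fun=> 1)) // sum_low1.
by field; rewrite gt_eqF.
Qed.

(** Of the 2n - 3 equally likely steps only the two cycles through [i] move [i]. *)
Lemma shuffle_fix1 (i : 'I_n) : (i < n - 2)%N ->
  \sum_x shuffle_mass R n x * (sgval x i == i)%:R =
  (2 * n%:R - 5) / (2 * n%:R - 3).
Proof.
move=> ilt; rewrite (sum_fix (g := fun s => (s i == i)%:R)
  (f := fun j => 1 - (j == i)%:R)) ?perm1 ?eqxx //.
  by rewrite sumrB sum_low1 sum_low_eq //; congr (_ / _); ring.
move=> j c d *; rewrite cycle3_low //.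
by case: (j == i); rewrite /= ?subrr ?subr0.
Qed.

(** Four cycles move [i] or [l], two through each; none goes through both. *)
Lemma shuffle_fix2 (i l : 'I_n) : (i < n - 2)%N -> (l < n - 2)%N -> i != l ->
  \sum_x shuffle_mass R n x * ((sgval x i == i) && (sgval x l == l))%:R =
  (2 * n%:R - 7) / (2 * n%:R - 3).
Proof.
move=> ilt llt il.
rewrite (sum_fix (g := fun s => ((s i == i) && (s l == l))%:R)
  (f := fun j => 1 - (j == i)%:R - (j == l)%:R)) ?perm1 ?eqxx //.
  by rewrite !sumrB sum_low1 !sum_low_eq //; congr (_ / _); ring.
move=> j c d *; rewrite !cycle3_low //.
have [->|] := eqVneq j i; first by rewrite (negbTE il) /= subrr subr0.
by case: (j == l); rewrite /= ?subr0 ?subrr.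
Qed.

Lemma shuffle_tv_ge k :
  1 - 21 / 4 / ((n%:R - 2) * (1 - (n%:R - 3 / 2)^-1) ^+ k) <=
  tv_dist (convn (shuffle_mass R n) k) (uniform_mass R (altT n)).
Proof.
have aE : 1 - (n%:R - 3 / 2)^-1 = (2 * n%:R - 5) / (2 * n%:R - 3) :> R.
  by field; rewrite !gt_eqF //; lra.
have cE : n%:R - 2 = #|[set i : 'I_n | (i < n - 2)%N]%SET|%:R :> R.
  by rewrite card_low natrB // ltnW.
have n3 : 3 <= n%:R :> R by rewrite ler_nat.
have pos : 0 < (n%:R - 2) * (1 - (n%:R - 3 / 2)^-1) ^+ k :> R.
  apply: mulr_gt0; first lra.
  by rewrite aE exprn_gt0 // divr_gt0 //; lra.
rewrite cE aE; apply: (@second_moment_tv_dist _ _ _ shuffle_mass_ge0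
  sum_shuffle_mass1 _ _ (fun i x => sgval x i == i) _
  ((2 * n%:R - 7) / (2 * n%:R - 3))).
- by move=> i; rewrite perm1.
- by move=> i s t /eqP si /eqP ti; rewrite permM si ti.
- by move=> i; rewrite inE; exact: shuffle_fix1.
- by move=> i j; rewrite !inE; exact: shuffle_fix2.
(* With x = 2n - 5 this is (x - 2)(x + 2) <= x^2. *)
- rewrite exprMn exprVn ler_pdivlMr ?exprn_gt0 // expr2 mulrA divfK ?gt_eqF //.
  nra.
- exact: sum_fixed_points.
- by rewrite -aE -cE.
Qed.

Lemma shuffle_tv_le1 k :
  tv_dist (convn (shuffle_mass R n) k) (uniform_mass R (altT n)) <= 1.
Proof.
apply: tv_dist_le1.
- exact: convn_ge0 shuffle_mass_ge0 k.
- exact: uniform_ge0.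
- exact: sum_convn1 sum_shuffle_mass1 k.
- exact: sum_uniform.
Qed.

(** The base of the power lies in [0, 1]. This carries a lower bound on the mean from a later time
    to an earlier one. *)
Lemma mean_untouched_anti k l : (k <= l)%N ->
  (n%:R - 2) * (1 - (n%:R - 3 / 2)^-1) ^+ l <=
  (n%:R - 2) * (1 - (n%:R - 3 / 2)^-1) ^+ k :> R.
Proof.
move=> kl; have n3 : 3 <= n%:R :> R by rewrite ler_nat.
have y1 : 1 <= n%:R - 3 / 2 :> R by lra.
apply: ler_wpM2l; first lra.
apply: ler_wiXn2l => //; first by rewrite subr_ge0 invf_le1 //; lra.
by rewrite lerBlDr lerDl invr_ge0; lra.
Qed.

Lemma shuffle_tv_near1 (e : R) k : 0 < e ->
  21 / 4 / e <= (n%:R - 2) * (1 - (n%:R - 3 / 2)^-1) ^+ k ->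
  `|1 - tv_dist (convn (shuffle_mass R n) k) (uniform_mass R (altT n))| <= e.
Proof.
move=> e0; have := shuffle_tv_ge k; have := shuffle_tv_le1 k.
set M := (n%:R - 2) * _ => t1 t2 M1; rewrite ger0_norm ?subr_ge0 //.
have M0 : 0 < M by apply: lt_le_trans M1; rewrite divr_gt0.
have : 21 / 4 / M <= e by rewrite ler_pdivrMr // [e * M]mulrC -ler_pdivrMr.
lra.
Qed.

End ShuffleMass.

(** * Limit of the mean number of unmoved points *)

Section Asymptotics.
Context (R : realType).
Implicit Types c d : R.

(** From ln n = 2 ln (sqrt n) and ln x < x. *)
Let ln_nat n : (0 < n)%N -> 0 <= ln (n%:R : R) <= 2 * Num.sqrt n%:R.
Proof.
move=> n0; rewrite ln_ge0 ?ler1n //=.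
have s0 : 0 < Num.sqrt n%:R :> R by rewrite sqrtr_gt0 ltr0n.
rewrite -[in leLHS](sqr_sqrtr (ler0n R n)) lnXn // -[_ *+ 2]mulr_natl.
by rewrite ler_pM2l //; apply/ltW/ln_sublinear.
Qed.

Lemma ln_div_cvg0 c d : (ln n%:R + c) / (n%:R - d) @[n --> \oo] --> (0 : R).
Proof.
apply/cvgr0Pnorm_le => e e0.
(* With s = sqrt n >= 1 the numerator is at most (2 + |c|) s and, once n >= 2|d|, the denominator is
   at least s^2 / 2; the quotient is then at most [e] for s >= [A]. *)
pose A := 2 * (2 + `|c|) / e.
have A0 : 0 <= A by rewrite divr_ge0 ?mulr_ge0 ?addr_ge0 // ltW.
near=> n.
have n1 : 1 <= n%:R :> R by near: n; exact: nbhs_infty_ger.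
have nd : 2 * `|d| <= n%:R :> R by near: n; exact: nbhs_infty_ger.
have nA : A ^+ 2 <= n%:R :> R by near: n; exact: nbhs_infty_ger.
have /ln_nat/andP[L0 L1] : (0 < n)%N by rewrite -(ltr0n R); lra.
set s := Num.sqrt n%:R in L1.
have s2 : s ^+ 2 = n%:R by rewrite sqr_sqrtr.
have s1 : 1 <= s by rewrite -sqrtr1; exact: ler_wsqrtr.
have sA : A <= s by rewrite -(ger0_norm A0) -sqrtr_sqr; exact: ler_wsqrtr.
have dd := ler_norm d.
have D : s ^+ 2 / 2 <= n%:R - d by rewrite s2; lra.
have D0 : 0 < n%:R - d by apply: lt_le_trans D; nra.
rewrite normrM normfV (gtr0_norm D0) ler_pdivrMr //.
apply: (@le_trans _ _ ((2 + `|c|) * s)).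
  apply: le_trans (ler_normD _ _) _; rewrite (ger0_norm L0).
  have := normr_ge0 c; nra.
apply: le_trans (ler_wpM2l (ltW e0) D).
have := ler_wpM2r (ltW e0) sA.
rewrite {1}/A divfK ?gt_eqF // => H; nra.
Unshelve. all: end_near. Qed.

Let natrB_cvg0 d : (n%:R - d)^-1 @[n --> \oo] --> (0 : R).
Proof.
apply/gtr0_cvgV0.
  near=> n; rewrite subr_gt0; near: n; exact: nbhs_infty_gtr.
apply/cvgryPge => A; near=> n; rewrite lerBrDr; near: n.
exact: nbhs_infty_ger.
Unshelve. all: end_near. Qed.

(** The condition on [n] says -c <= eps ln n. So the times of the second claim eventually precede
    those of the first, for any fixed [c]. *)
Lemma cutoff_time_le n (eps c : R) : (2 < n)%N -> 0 < eps ->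
  expR (- c / eps) <= n%:R ->
  (Num.truncn ((1 - eps) * (n%:R - 3 / 2) * ln n%:R) <=
   Num.truncn ((n%:R - 3 / 2) * (ln n%:R + c)))%N.
Proof.
move=> n2 e0 nc; have n3 : 3 <= n%:R :> R by rewrite ler_nat.
have n0 : 0 < n%:R :> R by lra.
have lnc : - c <= eps * ln n%:R.
  by rewrite mulrC -ler_pdivrMr // -ler_expR lnK ?posrE.
apply: le_truncn; rewrite mulrAC [leRHS]mulrC ler_pM2r; lra.
Qed.

(** With y = n - 3/2, the inequalities exp(-1/(y - 1)) <= 1 - 1/y <= exp(-1/y) and the fact that the
    exponent is within 1 of y (ln n + c) squeeze the mean. *)
Lemma mean_untouched_cvg c :
  (n%:R - 2) * (1 - (n%:R - 3 / 2)^-1) ^+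
    Num.truncn ((n%:R - 3 / 2) * (ln n%:R + c)) @[n --> \oo] --> expR (- c).
Proof.
have cont (u : nat -> R) l : u n @[n --> \oo] --> l ->
    expR (u n) @[n --> \oo] --> expR l.
  by move=> ul; apply: continuous_cvg ul; exact: continuous_expR.
(* The factor 1 - 2/n is (n - 2)/n; [n%:R - 0] has the shape of [natrB_cvg0]. *)
apply: (@squeeze_cvgr _ _ _ _
  (fun n => (1 - 2 * (n%:R - 0)^-1) *
     (expR (- c) * expR (- ((ln n%:R + c) / (n%:R - 5 / 2)))))
  (fun n => expR (- c) * expR ((n%:R - 3 / 2)^-1))).
- near=> n.
  have n3 : 3 <= n%:R :> R by near: n; exact: nbhs_infty_ger.
  have nc : expR (- c) <= n%:R :> R by near: n; exact: nbhs_infty_ger.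
  have n0 : 0 < n%:R :> R by lra.
  (* [Num.truncn] is 0 at negative arguments, so it lies below its argument only when that is
     nonnegative. *)
  have L0 : 0 <= ln n%:R + c.
    by rewrite -[c]opprK subr_ge0 -ler_expR lnK.
  have y0 : 0 < n%:R - 3 / 2 :> R by lra.
  set y := n%:R - 3 / 2 in y0 *.
  set k := Num.truncn _.
  have k1 : k%:R <= y * (ln n%:R + c) by rewrite truncn_le mulr_ge0 // ltW.
  have k2 : y * (ln n%:R + c) < k%:R + 1.
    by rewrite natr1; apply: truncnS_gt.
  have eL : n%:R * expR (- (ln n%:R + c)) = expR (- c).
    rewrite opprD expRD (expRN (ln _)) lnK ?posrE // mulrA.
    by rewrite mulfV ?mul1r // gt_eqF.
  apply/andP; split.
    have -> : n%:R - 5 / 2 = y - 1 by rewrite /y; lra.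
    have y1 : 0 < y - 1 by rewrite /y; lra.
    have -> : 1 - 2 * (n%:R - 0)^-1 = (n%:R - 2) / n%:R :> R.
      by rewrite subr0; field; rewrite gt_eqF.
    rewrite -mulrA; apply: ler_wpM2l; first lra.
    rewrite -eL -!mulrA mulKf ?gt_eqF // -expRD.
    (* In this form 1 + t <= exp t, used with t = 1/(y - 1), bounds the base from below. *)
    have -> : 1 - y^-1 = (1 + (y - 1)^-1)^-1.
      by field; rewrite !gt_eqF //; lra.
    apply: (@le_trans _ _ (expR (- (y - 1)^-1) ^+ k)).
      rewrite -expRM_natl ler_expR.
      move: k1.
      have -> : y * (ln n%:R + c) =
          (y - 1) * (ln n%:R + c + (ln n%:R + c) / (y - 1)).
        by field; rewrite gt_eqF.
      rewrite -ler_pdivrMl // mulrC; lra.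
    apply: lerXn2r;
      rewrite ?nnegrE ?expR_ge0 ?invr_ge0 ?addr_ge0 ?invr_ge0 ?(ltW y1) //.
    rewrite expRN lef_pV2 ?posrE ?expR_gt0 ?expR_ge1Dx //.
    by rewrite addr_gt0 // invr_gt0.
  apply: (@le_trans _ _ (n%:R * expR (- y^-1) ^+ k)).
    apply: ler_pM; [lra| | lra | ].
      rewrite exprn_ge0 // subr_ge0 invf_le1 // /y; lra.
    apply: lerXn2r; rewrite ?nnegrE ?expR_ge0 ?expR_ge1Dx //.
    by rewrite subr_ge0 invf_le1 // /y; lra.
  rewrite -eL -mulrA ler_pM2l // -expRM_natl -expRD ler_expR.
  move: k2; have -> : k%:R + 1 = y * (k%:R / y + y^-1) by field; rewrite gt_eqF.
  rewrite ltr_pM2l // => ?; lra.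
- have E : expR (- c) = (1 - 2 * 0) * (expR (- c) * expR (- 0)).
    by rewrite mulr0 subr0 oppr0 expR0 mul1r mulr1.
  rewrite [X in _ --> X]E; apply: cvgM.
    by apply: cvgB; [exact: cvg_cst|apply: cvgM; [exact: cvg_cst|]].
  apply: cvgM; first exact: cvg_cst.
  by apply: cont; apply: cvgN; exact: ln_div_cvg0.
- rewrite -[X in _ --> X]mulr1; apply: cvgM; first exact: cvg_cst.
  by rewrite -[X in _ --> X]expR0; apply: cont.
Unshelve. all: end_near. Qed.

End Asymptotics.

Theorem theorem4p7 (R : realType) :
  (exists2 c0 : R, c0 < 0 &
    forall c : R, c <= c0 ->
    exists2 delta : nat -> R, delta n @[n --> \oo] --> (0 : R) &
    \forall n \near \oo,
      let k := Num.truncn ((n%:R - 3 / 2) * (ln n%:R + c)) in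
      1 - 6 / (1 + expR (- c) * (1 + delta n)) <=
        tv_dist (convn (shuffle_mass R n) k) (uniform_mass R (altT n)))
  /\
  (forall eps : R, 0 < eps < 1 ->
    let k n := Num.truncn ((1 - eps) * (n%:R - 3 / 2) * ln n%:R) in
    tv_dist (convn (shuffle_mass R n) (k n)) (uniform_mass R (altT n))
      @[n --> \oo] --> (1 : R)).
Proof.
split.
  (* For c <= -8, exp(-c) >= 1 - c >= 9 > 7, so the mean eventually exceeds the 7 required at the
     end. *)
  exists (-8) => [|c c8]; first lra.
  pose m n : R := (n%:R - 2) * (1 - (n%:R - 3 / 2)^-1) ^+
    Num.truncn ((n%:R - 3 / 2) * (ln n%:R + c)).
  have mc : m n @[n --> \oo] --> expR (- c) := @mean_untouched_cvg R c.
  have e0 : 0 < expR (- c) by exact: expR_gt0.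
  (* Chosen so that exp(-c) (1 + delta n) is exactly the mean [m n]. *)
  exists (fun n => m n / expR (- c) - 1).
    rewrite -[X in _ --> X](subrr 1) -[X in _ --> X - _](mulfV (lt0r_neq0 e0)).
    by apply: cvgB; [apply: cvgM; [exact: mc|exact: cvg_cst]|exact: cvg_cst].
  have e7 : 7 < expR (- c) by apply: lt_le_trans (expR_ge1Dx _); lra.
  near=> n; set k := Num.truncn _.
  have n2 : (2 < n)%N by near: n; exact: nbhs_infty_ge.
  have m7 : 7 <= m n.
    by near: n; exact: (cvgr_ge _ mc _ e7).
  have -> : expR (- c) * (1 + (m n / expR (- c) - 1)) = m n.
    by field; rewrite gt_eqF.
  apply: le_trans (shuffle_tv_ge R n2 k); rewrite -/(m n) lerD2l lerN2.
  rewrite ler_pdivrMr; last lra.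
  rewrite mulrAC ler_pdivlMr; last lra.
  lra.
move=> eps /andP[e0 e1] k; apply/cvgrPdist_le => e epos.
(* Since exp x > x, the limit exp(-c) of the mean exceeds the level at which the distance is within
   [e] of 1. *)
pose c : R := - (21 / 4 / e).
have cA : 21 / 4 / e < expR (- c).
  by rewrite opprK; apply: lt_le_trans (expR_ge1Dx _); rewrite ltrDr.
near=> n.
have n2 : (2 < n)%N by near: n; exact: nbhs_infty_ge.
have nc : expR (- c / eps) <= n%:R by near: n; exact: nbhs_infty_ger.
pose kc := Num.truncn ((n%:R - 3 / 2) * (ln (n%:R : R) + c)).
have mge : 21 / 4 / e <= (n%:R - 2) * (1 - (n%:R - 3 / 2)^-1) ^+ kc.
  by rewrite /kc; near: n; exact: (cvgr_ge _ (@mean_untouched_cvg R c) _ cA).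
apply: shuffle_tv_near1 => //; apply: le_trans mge _.
apply: mean_untouched_anti => //; exact: cutoff_time_le.
Unshelve. all: end_near. Qed.
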